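(* Let $\gamma>0$ and a mobility function $b$ satisfying (B) be given (known). Then, for smooth solutions $\phi$ of the Cahn-Hilliard system on $[0,T]\times\Omega$ and $0\le t\le T$, the function $f'$ is uniquely determined on $R_t=\{s=\phi(x,t): x\in\Omega\}$ from observations of $\phi(\cdot,t)$ and $\partial_t\phi(\cdot,t)$ on $\Omega$. That is: let $f_1,f_2$ be two functions satisfying (F), and for $i=1,2$ let $(\phi_i,\mu_i)$ be a smooth periodic solution on $[0,T]\times\Omega$ of $$\partial_t\phi_i=\operatorname{div}\big(b(\phi_i)\nabla\mu_i\big),\qquad \mu_i=-\gamma\Delta\phi_i+f_i(\phi_i).$$ If $t\in[0,T]$ is such that $\phi_1(\cdot,t)=\phi_2(\cdot,t)=:\phi(\cdot,t)$ and $\partial_t\phi_1(\cdot,t)=\partial_t\phi_2(\cdot,t)$ on $\Omega$, then $f_1'(s)=f_2'(s)$ for all $s\in R_t=\{\phi(x,t): x\in\Omega\}$.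
   Context: $\Omega$ is the $d$-dimensional torus $\mathbb{T}^d$, $d\in\{1,2,3\}$; all functions on $\Omega$ are periodic. (B): $b:\mathbb{R}\to\mathbb{R}_+$, $b\in C^2(\mathbb{R})$, and there are constants $\beta_1,\beta_2,\beta_3,\beta_4$ with $0<\beta_1\le b(s)\le\beta_2$ for all $s$, $\|b'\|_\infty\le\beta_3$, $\|b''\|_\infty\le\beta_4$. (F): $f=F'$ with $F\in C^4(\mathbb{R})$ such that $F(s)\ge-\kappa$ and $F''(s)\ge-\kappa$ for all $s$ and some $\kappa\ge0$, and $|F^{(k)}(s)|\le p_k+q_k|s|^{4-k}$ for $0\le k\le4$ and all $s$, with constants $p_k,q_k\ge0$. The Cahn-Hilliard system with parameters $(\gamma,b,f)$ is $\partial_t\phi=\operatorname{div}(b(\phi)\nabla\mu)$, $\mu=-\gamma\Delta\phi+f(\phi)$ on $\Omega$ with periodic boundary conditions.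
   Formalization: The formal theorem additionally assumes that φ(·,t) is not constant on Ω; without this the claim fails, e.g. φ₁=φ₂=0, μ₁=μ₂=0, b=1, γ=1 with F₁(s)=s² and F₂=0 gives f₁'(0)=2 but f₂'(0)=0. *)

(* Defs.v *)
From HB Require Import structures.
From mathcomp Require Import all_boot all_order all_algebra.
From mathcomp Require Import all_classical all_reals all_analysis.
Set Implicit Arguments.
Unset Strict Implicit.
Unset Printing Implicit Defensive.
Import Order.TTheory GRing.Theory Num.Theory numFieldNormedType.Exports.
Local Open Scope ring_scope.
Local Open Scope classical_set_scope.

Definition class_C {R : realType} (n : nat) (g : R -> R) : Prop :=
  (forall k : nat, (k < n)%N -> forall s : R, derivable g^`(k) s 1) /\
  (forall k : nat, (k <= n)%N -> continuous g^`(k)).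

(* Nonnegativity of b is implied by b >= beta1 > 0. *)
Definition mobility_B {R : realType} (b : R -> R) : Prop :=
  class_C 2 b /\
  exists beta1 beta2 beta3 beta4 : R,
    [/\ 0 < beta1,
        forall s, beta1 <= b s <= beta2,
        forall s, `|b^`() s| <= beta3 &
        forall s, `|b^`(2) s| <= beta4].

Definition potential_F {R : realType} (f : R -> R) : Prop :=
  exists (F : R -> R) (kappa : R) (p q : nat -> R),
    [/\ class_C 4 F,
        (forall s, f s = F^`() s),
        0 <= kappa,
        (forall s, - kappa <= F s /\ - kappa <= F^`(2) s) &
        forall k : nat, (k <= 4)%N ->
          [/\ 0 <= p k, 0 <= q k &
              forall s, `|F^`(k) s| <= p k + q k * `|s| ^+ (4 - k)] ].

Section SpaceDerivatives.
Context {R : realType} {d : nat}.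
Implicit Types (v : 'rV[R]_d -> R) (V : 'rV[R]_d -> 'rV[R]_d).

Definition partial (j : 'I_d) v (x : 'rV[R]_d) : R := 'D_('e_j) v x.

(* [iter_partial [:: j1; ..; jk] v] is d_j1 (.. (d_jk v)). *)
Definition iter_partial (js : seq 'I_d) v : 'rV[R]_d -> R :=
  foldr partial v js.

Definition grad v (x : 'rV[R]_d) : 'rV[R]_d := \row_j partial j v x.

Definition divergence V (x : 'rV[R]_d) : R :=
  \sum_(j < d) partial j (fun y => V y 0 j) x.

Definition laplacian v (x : 'rV[R]_d) : R :=
  \sum_(j < d) partial j (partial j v) x.

(* Functions on the torus (R / Z)^d are Z^d-periodic functions on R^d. *)
Definition periodic v : Prop := forall j x, v (x + 'e_j) = v x.

End SpaceDerivatives.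

Section SpaceTime.
Context {R : realType} {d : nat}.
Implicit Types (T : R) (u : R -> 'rV[R]_d -> R).

(* The difference quotient only uses times in [0, T], so that the derivative
   is one-sided at t = 0 and t = T; values of u at other times are
   irrelevant. *)
Definition dt_quotient u t x (h : R) : R := h^-1 * (u (t + h) x - u t x).

Definition dt_filter T (t : R) : set_system R :=
  within [set h | 0 <= t + h <= T] 0^'.

Definition dt_derivable T u t x : Prop :=
  cvg (dt_quotient u t x @ dt_filter T t).

Definition dt T u t x : R := lim (dt_quotient u t x @ dt_filter T t).

Definition continuous_on_slab T u : Prop :=
  {within `[0, T] `*` [set: 'rV[R]_d],
    continuous (fun z : R * 'rV[R]_d => u z.1 z.2)}.

(* All space derivatives of order <= k exist and are jointly continuous on
   [0, T] x R^d. *)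
Definition space_class_C (k : nat) T u : Prop :=
  (forall js : seq 'I_d, (size js < k)%N ->
     forall t x j, 0 <= t <= T -> derivable (iter_partial js (u t)) x 'e_j) /\
  (forall js : seq 'I_d, (size js <= k)%N ->
     continuous_on_slab T (fun t => iter_partial js (u t))).

Definition time_class_C1 T u : Prop :=
  (forall t x, 0 <= t <= T -> dt_derivable T u t x) /\
  continuous_on_slab T (dt T u).

(* Smoothness of the solution means that all derivatives occurring in the
   (fourth-order) system exist classically and are continuous up to t = 0 and
   t = T.  C^oo is not required: f is only of class C^3 and b of class C^2. *)
Definition cahn_hilliard_solution (gamma : R) (b f : R -> R) T
    (phi mu : R -> 'rV[R]_d -> R) : Prop :=
  [/\ (time_class_C1 T phi /\ space_class_C 4 T phi),
      space_class_C 2 T mu,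
      (forall t, 0 <= t <= T -> periodic (phi t) /\ periodic (mu t)),
      (forall t x, 0 <= t <= T ->
         dt T phi t x =
         divergence (fun y => b (phi t y) *: grad (mu t) y) x) &
      (forall t x, 0 <= t <= T ->
         mu t x = - gamma * laplacian (phi t) x + f (phi t x)) ].

End SpaceTime.

(* Main.v *)
Require Import Defs.
From HB Require Import structures.
From mathcomp Require Import all_boot all_order all_algebra.
From mathcomp Require Import ring lra.
From mathcomp Require Import all_classical all_reals all_analysis.
Import Order.TTheory GRing.Theory Num.Theory numFieldNormedType.Exports.
Local Open Scope ring_scope.
Local Open Scope classical_set_scope.

(** Write phi for the common value of the two solutions at time t and
    g = f1 - f2.  Subtracting the two formulas for the chemical potential
    gives mu1 - mu2 = g(phi), since the surface tension terms agree; the two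
    evolution equations then give div (b(phi) grad g(phi)) = 0.

    Testing this equation with g(phi) and integrating over the torus would
    show that g(phi) is constant.  Integration by parts in several variables
    can be avoided because the flux only involves phi: if H is a primitive of
    b g', then b(phi) grad g(phi) = grad H(phi), so H(phi) is a harmonic
    function on the torus, hence constant ([periodic_harmonic_constant]).

    The range of phi is an interval, because phi is continuous on a connected
    space, and it is not a single point, because phi is not constant.  Thus H
    is constant on a nondegenerate interval, its derivative b g' vanishes
    there, end points included, and b > 0 leaves g' = 0
    ([range_weighted_derivative_eq0]).

    That periodic harmonic functions are constant is proved by a reflection
    argument resting on the weak maximum principle alone.  For a coordinate
    direction e, the function
      u(x, s) = h(x + s e) - h(x - s e)
    is periodic in x, vanishes at s = 0 and satisfies d_s^2 u = d_e^2 u, so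
    it is harmonic for the operator that has d_s^2 in the place of d_e^2.  On
    0 <= s <= S it lies below the concave barrier c s (2S - s) with
    c = 2M / S^2 and M a bound of |h| ([reflected_difference_le]).  As S tends
    to infinity the barrier tends to 0 for fixed s, so u <= 0; the same for
    - h gives u = 0, which says that h is invariant under every translation
    along e. *)

Set Implicit Arguments.
Unset Strict Implicit.

(** * Derivatives along lines *)

(** A directional derivative is the derivative of the restriction to a line,
    at every point of that line: this reduces calculus in several variables
    to the calculus of functions of one real variable. *)
Lemma is_derive_line (R : numFieldType) (V W : normedModType R) (f : V -> W)
    (x v : V) (r : R) (df : W) :
  is_derive r 1 (fun h : R => f (h *: v + x)) df <->
  is_derive (r *: v + x) v f df.
Proof.
have E : (fun h : R => h^-1 *: (f ((h%:A + r) *: v + x) - f (r *: v + x))) =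
         (fun h : R => h^-1 *: (f (h *: v + (r *: v + x)) - f (r *: v + x))).
  by apply/funext => h; rewrite [h%:A]mulr1 scalerDl addrA.
by split=> -[H1 H2]; split; move: H1 H2; rewrite /derive /derivable /= E.
Qed.

(** The inner function is only known to have a derivative in the direction v,
    so the one-variable chain rule is applied on the line through x. *)
Lemma is_derive_comp_along (R : realType) (V : normedModType R) (phi : V -> R)
    (H : R -> R) (x v : V) (a c : R) :
  is_derive x v phi c -> is_derive (phi x) 1 H a ->
  is_derive x v (H \o phi) (a * c).
Proof.
have E : 0 *: v + x = x by rewrite scale0r add0r.
rewrite -{1 3}E => /is_derive_line dphi dH; apply/is_derive_line.
by apply: is_derive1_comp; rewrite /= ?scale0r ?add0r.
Qed.

(** If f'' were positive, f' would be positive just to the right of its zero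
    c, and f would increase there by the mean value theorem. *)
Lemma second_derivative_at_max (R : realType) (f f' : R -> R) (c e f'' : R) :
  0 < e ->
  (forall t, t \in `]c - e, c + e[%R -> is_derive t 1 f (f' t)) ->
  (forall t, t \in `]c - e, c + e[%R -> f t <= f c) ->
  is_derive c 1 f' f'' -> f'' <= 0.
Proof.
move=> e0 df fmax df'; rewrite leNgt; apply/negP => f''0.
have cin : c \in `]c - e, c + e[%R by rewrite in_itv /=; lra.
have f'c : f' c = 0.
  have cc : c - e <= c + e by lra.
  have [|_] := @derive1_at_max _ f _ _ c cc _ cin fmax.
    by move=> t /df [].
  by have [_ <-] := df _ cin.
case: df' => df' f''E.
move: f''0; rewrite -f''E => f''0.
have /nbhs_ballP[r /= r0 hr] : nbhs 0^' [set h : R | 0 < h^-1 *: (f' (h%:A + c) - f' c)].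
  exact: (df' [set x | 0 < x] (open_nbhs_nbhs (conj (@open_gt _ 0) f''0))).
pose s := Num.min (r / 2) (e / 2).
have s0 : 0 < s by rewrite lt_min; apply/andP; split; lra.
have sr : s < r by rewrite gt_min; apply/orP; left; lra.
have se : s < e by rewrite gt_min; apply/orP; right; lra.
have f'pos h : 0 < h -> h <= s -> 0 < f' (h + c).
  move=> h0 hs; have := hr h; rewrite /ball /= sub0r normrN gtr0_norm//.
  rewrite [h%:A]mulr1 f'c subr0 => /(_ (le_lt_trans hs sr) (lt0r_neq0 h0)).
  by rewrite pmulr_rgt0 ?invr_gt0.
have cs : c < c + s by lra.
have sub x : x \in `[c, c + s]%R -> x \in `]c - e, c + e[%R.
  by rewrite !in_itv /= => /andP[? ?]; apply/andP; split; lra.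
have dfcs x : x \in `]c, c + s[%R -> is_derive x 1 f (f' x).
  by move=> /subset_itv_oo_cc/sub/df.
have fcont : {within `[c, c + s], continuous f}.
  by apply: derivable_within_continuous => x /sub/df[].
have [d] := MVT cs dfcs fcont.
rewrite in_itv /= => /andP[d1 d2] fE.
have f'd : 0 < f' d by rewrite -[d](subrK c); apply: f'pos; lra.
have fle : f (c + s) <= f c by apply: fmax; rewrite in_itv /=; lra.
have : 0 < f' d * (c + s - c) by rewrite mulr_gt0//; lra.
by rewrite -fE subr_gt0 ltNge fle.
Qed.

(** * Periods *)

Section Periods.
Variables (R : realType) (d : nat).
Implicit Types (h : 'rV[R]_d -> R) (v : 'rV[R]_d).

Definition is_period h v : Prop := forall x, h (x + v) = h x.

Lemma is_periodN h v : is_period h v -> is_period h (- v).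
Proof. by move=> pv x; rewrite -[in RHS](subrK v x) pv. Qed.

Lemma is_period_int h v (n : int) : is_period h v -> is_period h (v *~ n).
Proof.
have pn m : is_period h v -> is_period h (v *+ m).
  move=> pv; elim: m => [|m IH] x; first by rewrite mulr0n addr0.
  by rewrite mulrS addrA IH pv.
case: n => m pv; first exact: pn.
by rewrite NegzE mulrNz; apply: is_periodN; apply: pn.
Qed.

(** The periods form a subgroup, so it is enough to test the components. *)
Lemma is_period_row h (a : 'I_d -> R) :
  (forall j, is_period h (a j *: 'e_j)) -> is_period h (\row_j a j).
Proof.
move=> pa; rewrite [\row__ _]row_sum_delta.
elim/big_ind: _ => [x|v w pv pw x|j _].
- by rewrite addr0.
- by rewrite addrA pw pv.
- by rewrite mxE; apply: pa.
Qed.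

Lemma periodic_floor h : Defs.periodic h ->
  forall x : 'rV[R]_d, is_period h (\row_j (Num.floor (x 0 j))%:~R).
Proof.
move=> ph x; apply: is_period_row => j.
by rewrite scaler_int; apply: is_period_int => y; apply: ph.
Qed.

End Periods.

(** * Harmonic functions on the torus *)

Section PeriodicHarmonic.
Variables (R : realType) (d : nat).
Implicit Types (g h : 'rV[R]_d -> R) (v x y : 'rV[R]_d) (j k : 'I_d).

Lemma unit_cube_compact :
  compact [set x : 'rV[R]_d | forall j, `[0, 1]%classic (x ord0 j)].
Proof.
by apply: (@rV_compact R d (fun=> `[0, 1]%classic)) => _; apply: segment_compact.
Qed.

(** The representative x0 of x is the same for all translates, so suprema over
    the whole space of expressions in translates of h are suprema over the
    compact unit cube. *)
Lemma periodic_representative h : Defs.periodic h ->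
  forall x, exists2 x0 : 'rV[R]_d, (forall j, `[0, 1]%classic (x0 ord0 j)) &
    forall v, h (v + x) = h (v + x0).
Proof.
move=> ph x; exists (x - \row_j (Num.floor (x 0 j))%:~R).
  move=> j; rewrite !mxE /= in_itv /= subr_ge0 floor_le lerBlDl.
  by have /ltW := floorD1_gt (x ord0 j); rewrite intrD.
by move=> v; rewrite addrA (is_periodN (periodic_floor ph x)).
Qed.

Lemma periodic_bounded h : continuous h -> Defs.periodic h ->
  exists2 M, 0 < M & forall x, `|h x| <= M.
Proof.
move=> ch ph.
have ne : [set x : 'rV[R]_d | forall j, `[0, 1]%classic (x ord0 j)] !=set0.
  by exists 0 => j; rewrite mxE /= in_itv /= lexx ler01.
have [|c _ cmax] := compact_EVT_max ne unit_cube_compact (f := fun x => `|h x|).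
  apply: continuous_subspaceT => x.
  apply: (@continuous_comp _ _ _ h Num.norm); first exact: ch.
  exact: norm_continuous.
exists (`|h c| + 1) => [|x]; first by rewrite ltr_wpDl.
have [x0 x0c] := periodic_representative ph x.
move=> /(_ 0); rewrite !add0r => ->; apply: (le_trans (cmax x0 _)).
  by rewrite inE.
by rewrite lerDl.
Qed.

(** The regularity is the one under which the Laplacian is a sum of genuine
    second derivatives along lines, to which the second derivative test
    applies at a maximum. *)
Definition periodic_harmonic h : Prop :=
  [/\ continuous h, Defs.periodic h,
      forall k x, derivable h x 'e_k,
      forall k x, derivable (partial k h) x 'e_k &
      forall x, laplacian h x = 0].

Lemma is_derive_partial_line g k y (t : R) : (forall x, derivable g x 'e_k) ->
  is_derive t 1 (fun a : R => g (a *: 'e_k + y)) (partial k g (t *: 'e_k + y)).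
Proof. by move=> dg; apply/is_derive_line; exact: derivableP. Qed.

Lemma is_derive_partial_reflected_line g k y (t : R) :
  (forall x, derivable g x 'e_k) ->
  is_derive t 1 (fun a : R => g (- a *: 'e_k + y))
    (- partial k g (- t *: 'e_k + y)).
Proof.
move=> dg; rewrite -mulrN1.
apply: (@is_derive1_comp _ (fun a => g (a *: 'e_k + y)) -%R).
exact: is_derive_partial_line.
Qed.

Lemma is_derive_barrier (c S t : R) :
  is_derive t 1 (fun a => c * (a * (2 * S - a))) (c * (2 * (S - t))).
Proof.
have -> : (fun a : R => c * (a * (2 * S - a))) = c \*: (id * (cst (2 * S) - id)).
  by [].
apply: is_derive_eq.
by transitivity (c * (t * (0 - 1) + (2 * S - t) * 1)); [by []|ring].
Qed.

(** The function compared with 0 in the maximum principle is the reflected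
    difference minus the barrier, here along the variable of reflection. *)
Lemma is_derive_reflected_minus_barrier (c S : R) h j :
  (forall k x, derivable h x 'e_k) ->
  forall y (t : R),
  is_derive t 1
    (fun a : R => h (a *: 'e_j + y) - h (- a *: 'e_j + y) - c * (a * (2 * S - a)))
    (partial j h (t *: 'e_j + y) + partial j h (- t *: 'e_j + y)
     - c * (2 * (S - t))).
Proof.
move=> dh y t; apply: is_deriveB; last exact: is_derive_barrier.
rewrite -[X in _ + X]opprK; apply: is_deriveB.
  exact: is_derive_partial_line.
exact: is_derive_partial_reflected_line.
Qed.

(** The reflection a |-> - a changes the sign twice, so the second derivative
    of the reflected difference is the difference of the second derivatives. *)
Lemma is_derive2_reflected_minus_barrier (c S : R) h j :
  (forall k x, derivable (partial k h) x 'e_k) ->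
  forall y (t : R),
  is_derive t 1
    (fun a : R => partial j h (a *: 'e_j + y) + partial j h (- a *: 'e_j + y)
                  - c * (2 * (S - a)))
    (partial j (partial j h) (t *: 'e_j + y)
     - partial j (partial j h) (- t *: 'e_j + y) + 2 * c).
Proof.
move=> ddh y t; rewrite -[X in _ + X]opprK; apply: is_deriveB.
  apply: is_deriveD; first exact: is_derive_partial_line.
  exact: is_derive_partial_reflected_line.
have -> : (fun a : R => c * (2 * (S - a))) = (c * 2) \*: (cst S - id).
  by apply/funext => a; rewrite mulrA.
by apply: is_derive_eq; rewrite /GRing.scale /=; ring.
Qed.

(** Otherwise the reflected difference minus the barrier has a positive
    maximum over x and 0 <= s <= S.  It is not attained at s = 0, where both
    terms vanish, nor at s = S, where the barrier reaches 2M.  At an interior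
    maximum the second derivatives in x_k, for k <> j, and in s are all <= 0;
    their sum is a difference of two values of the Laplacian of h plus
    2c > 0, which is absurd. *)
Lemma reflected_difference_le h (j : 'I_d) (M S : R) :
  periodic_harmonic h ->
  0 < M -> (forall x, `|h x| <= M) -> 0 < S ->
  forall (x : 'rV[R]_d) (s : R), 0 <= s <= S ->
    h (s *: 'e_j + x) - h (- s *: 'e_j + x)
    <= (2 * M / S ^+ 2) * (s * (2 * S - s)).
Proof.
move=> [ch ph dh ddh lh] M0 hM S0 x s /andP[s0 sS].
set c := 2 * M / S ^+ 2.
have c0 : 0 < c by rewrite divr_gt0 ?mulr_gt0 ?exprn_gt0.
pose w (z : 'rV[R]_d * R) : R :=
  h (z.2 *: 'e_j + z.1) - h (- z.2 *: 'e_j + z.1) - c * (z.2 * (2 * S - z.2)).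
pose K := [set y : 'rV[R]_d | forall k, `[0, 1]%classic (y ord0 k)] `*` `[0, S].
have Kne : K !=set0.
  exists (0, 0); split => /= [k|]; rewrite ?mxE /= in_itv /= lexx ?ler01 //.
  exact: ltW.
have Kc : compact K.
  by apply: compact_setX; [exact: unit_cube_compact|exact: segment_compact].
have cw : continuous w.
  move=> z; apply: cvgB; last first.
    apply: cvgM; first exact: cvg_cst.
    by apply: cvgM; [exact: cvg_snd|apply: cvgB; [exact: cvg_cst|exact: cvg_snd]].
  apply: cvgB.
    apply: (@cvg_comp _ _ _ (fun z : 'rV[R]_d * R => z.2 *: 'e_j + z.1) h);
      last exact: ch.
    by apply: cvgD; [apply: cvgZr_tmp; exact: cvg_snd|exact: cvg_fst].
  apply: (@cvg_comp _ _ _ (fun z : 'rV[R]_d * R => - z.2 *: 'e_j + z.1) h);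
    last exact: ch.
  by apply: cvgD; [apply: cvgZr_tmp; apply: cvgN; exact: cvg_snd|exact: cvg_fst].
have [[x0 r] /set_mem[/= _ s0K] wmax] :=
  compact_EVT_max Kne Kc (continuous_subspaceT (A := K) cw).
have {}wmax (y : 'rV[R]_d) (a : R) : 0 <= a <= S -> w (y, a) <= w (x0, r).
  move=> aS; have [y0 y0c yE] := periodic_representative ph y.
  have -> : w (y, a) = w (y0, a) by rewrite /w /= !yE.
  by apply: wmax; rewrite inE; split => //=; rewrite in_itv.
rewrite leNgt; apply/negP => wpos.
have {wpos} : 0 < w (x0, r).
  by apply: lt_le_trans (wmax x s _); rewrite /w /= ?subr_gt0 // s0 sS.
move: s0K; rewrite in_itv /= => /andP[r0 rS] w0.
have {}r0 : 0 < r.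
  rewrite lt_neqAle r0 andbT; apply/eqP => rE; move: w0.
  by rewrite /w /= -rE oppr0 scale0r add0r mul0r mulr0 subr0 subrr ltxx.
have {}rS : r < S.
  rewrite lt_neqAle rS andbT; apply/eqP => rE; move: w0.
  rewrite /w /= rE; have -> : c * (S * (2 * S - S)) = 2 * M.
    by rewrite /c; field; rewrite gt_eqF.
  have := hM (S *: 'e_j + x0); have := hM (- S *: 'e_j + x0).
  by rewrite !ler_norml => /andP[? ?] /andP[? ?] ?; lra.
pose p := r *: 'e_j + x0; pose q := - r *: 'e_j + x0.
pose D k := partial k (partial k h) p - partial k (partial k h) q.
(* as x moves from x0 along 'e_k, the points p and q move together and the
   barrier is constant *)
have Dle k : D k <= 0.
  pose f (g : 'rV[R]_d -> R) (a : R) := g (a *: 'e_k + p) - g (a *: 'e_k + q).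
  have df (g : 'rV[R]_d -> R) : (forall x, derivable g x 'e_k) -> forall t : R,
      is_derive t 1 (f g) (f (partial k g) t).
    by move=> dg t; apply: is_deriveB; apply: is_derive_partial_line.
  have -> : D k = f (partial k (partial k h)) 0 by rewrite /f !scale0r !add0r.
  apply: (@second_derivative_at_max _ (f h) (f (partial k h)) 0 1 _ ltr01) => //.
  - by move=> t _; apply: df.
  - move=> t _; have := wmax (t *: 'e_k + x0) r.
    rewrite /w /f /= -/p -/q !scale0r !add0r lerD2r ![_ *: 'e_j + (_ + _)]addrCA.
    by apply; rewrite !ltW.
  - by apply: df.
have Dj : D j + 2 * c <= 0.
  (* e keeps s = r + t, for |t| < e, inside the interval [0, S] *)
  pose e := Num.min r (S - r).
  have e0 : 0 < e by rewrite lt_min; lra.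
  have er : e <= r by rewrite ge_min lexx.
  have eS : e <= S - r by rewrite ge_min lexx orbT.
  apply: second_derivative_at_max e0
    (fun t _ => is_derive_reflected_minus_barrier c S j dh x0 t) _
    (is_derive2_reflected_minus_barrier c S j ddh x0 r) => t.
  by rewrite in_itv /= => /andP[t1 t2]; apply: (wmax x0); lra.
have : \sum_k D k = 0.
  transitivity (laplacian h p - laplacian h q); first exact: sumrB.
  by rewrite (lh p) (lh q) subrr.
have rest : \sum_(k | k != j) D k <= 0 by apply: sumr_le0 => k _; apply: Dle.
by rewrite (bigD1 j) //= => E; lra.
Qed.

Lemma periodic_harmonicN h : periodic_harmonic h -> periodic_harmonic (- h).
Proof.
move=> [ch ph dh ddh lh].
have pN g k : (forall x, derivable g x 'e_k) -> partial k (- g) = - partial k g.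
  by move=> dg; apply/funext => x; exact: deriveN.
split.
- move=> x; apply: (@continuous_comp _ _ _ h -%R); first exact: ch.
  exact: oppr_continuous.
- by move=> j x; rewrite !fctE ph.
- by move=> k x; apply: derivableN.
- by move=> k x; rewrite pN //; apply: derivableN.
- move=> x; rewrite -oppr0 -(lh x) /laplacian -sumrN; apply: eq_bigr => k _.
  by rewrite pN // pN.
Qed.

(** The barrier of [reflected_difference_le] is at most 4 M s / S, which is
    arbitrarily small for fixed s. *)
Lemma reflected_le h j x (s : R) : periodic_harmonic h -> 0 <= s ->
  h (s *: 'e_j + x) <= h (- s *: 'e_j + x).
Proof.
move=> Hh s0; have [ch ph _ _ _] := Hh.
have [M M0 hM] := periodic_bounded ch ph.
rewrite -subr_le0 leNgt; apply/negP; set delta := (X in 0 < X) => delta0.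
have Ms0 : 0 <= M * s by rewrite mulr_ge0 // ltW.
(* S is any length with S >= s and 4 M s / S < delta *)
pose S := s + 4 * (M * s) / delta + 1.
have q0 : 0 <= 4 * (M * s) / delta by rewrite divr_ge0 ?mulr_ge0 // ltW.
have S0 : 0 < S by rewrite /S; lra.
have sS : 0 <= s <= S by rewrite s0 /S; lra.
have := reflected_difference_le j Hh M0 hM S0 x sS.
rewrite -/delta mulrAC ler_pdivlMr ?exprn_gt0 // => le1.
have le2 : delta * S ^+ 2 <= 4 * (M * s) * S.
  apply: le_trans le1 _; rewrite -subr_ge0.
  have -> : 4 * (M * s) * S - 2 * M * (s * (2 * S - s)) = 2 * (M * s * s) by ring.
  by rewrite !mulr_ge0 // ltW.
have : delta * S <= 4 * (M * s).
  by rewrite -(ler_pM2r S0) -mulrA -expr2.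
have : delta * (4 * (M * s) / delta) = 4 * (M * s) by rewrite mulrC divfK ?gt_eqF.
by rewrite /S !mulrDr => ->; have := mulr_ge0 (ltW delta0) s0; lra.
Qed.

(** Applied to h and - h, the one-sided comparison becomes an equality of the
    values at any two points symmetric about a centre on a line parallel to an
    axis.  As the centre is arbitrary, every vector is a period. *)
Lemma periodic_harmonic_constant h : periodic_harmonic h -> forall x y, h x = h y.
Proof.
move=> Hh.
have refl j x (s : R) : 0 <= s -> h (s *: 'e_j + x) = h (- s *: 'e_j + x).
  move=> s0; apply/eqP; rewrite eq_le reflected_le //=.
  have := reflected_le j x (periodic_harmonicN Hh) s0.
  by rewrite !fctE lerN2.
(* reflect about the midpoint of x and x + a e_j *)
have pos j (a : R) : 0 <= a -> is_period h (a *: 'e_j).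
  move=> a0 x; have := refl j (x + (a / 2) *: 'e_j) (a / 2).
  rewrite divr_ge0 // addrCA -scalerDl -splitr scaleNr addrCA addNr addr0.
  exact.
have per j (a : R) : is_period h (a *: 'e_j).
  have [a0|a0] := leP 0 a; first exact: pos.
  by rewrite -[a]opprK scaleNr; apply: is_periodN; apply: pos; lra.
move=> x y; have := is_period_row (fun j => per j ((x - y) ord0 j)) y.
have -> : \row_j (x - y) ord0 j = x - y by apply/rowP => j; rewrite mxE.
by rewrite addrC subrK.
Qed.

End PeriodicHarmonic.

(** * Functions constant on an interval of values *)

Lemma continuous_antiderivative (R : realType) (g : R -> R) (m : R) :
  continuous g ->
  exists H : R -> R, forall s, m < s -> is_derive s 1 H (g s).
Proof.
move=> cg; exists (fun s => \int[lebesgue_measure]_(t in `[m, s]) g t)%R => s ms.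
have s1 : s < s + 1 by rewrite ltrDl.
have ig : lebesgue_measure.-integrable `[m, s + 1] (EFin \o g).
  apply: continuous_compact_integrable; first exact: segment_compact.
  exact: continuous_subspaceT.
have [dH HE] := continuous_FTC1_closed s1 ig ms (cg s).
by split; rewrite // -derive1E.
Qed.

(** The derivative at the end point s0 is two-sided, so it can be computed from
    the difference quotients on the side of s1, which vanish. *)
Lemma derive_eq0_of_constant_on_interval (R : realType) (H : R -> R)
    (c s0 s1 a : R) :
  s0 != s1 -> is_derive s0 1 H a ->
  (forall s, Num.min s0 s1 <= s <= Num.max s0 s1 -> H s = c) -> a = 0.
Proof.
move=> ne [dH <-] Hc; apply/eqP/negPn/negP => Da0.
have /nbhs_ballP[r /= r0 hr] :
    nbhs 0^' [set h : R | h^-1 *: (H (h%:A + s0) - H s0) != 0].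
  exact: (dH [set x | x != 0] (open_nbhs_nbhs (conj (@open_neq _ 0) Da0))).
pose e := Num.min (r / 2) `|s1 - s0|.
have e0 : 0 < e by rewrite lt_min normr_gt0 subr_eq0 eq_sym ne divr_gt0.
have er : e < r by rewrite gt_min; apply/orP; left; lra.
have es : e <= `|s1 - s0| by rewrite ge_min lexx orbT.
(* a step from s0 towards s1 *)
pose h := Num.sg (s1 - s0) * e.
have := hr h; rewrite /ball /= sub0r normrN /h normrM normr_sg.
rewrite subr_eq0 [s1 == _]eq_sym ne mul1r.
rewrite gtr0_norm // mulf_eq0 sgr_eq0 subr_eq0 [s1 == _]eq_sym (negbTE ne) gt_eqF //.
move=> /(_ er isT); rewrite [(_ * e)%:A]mulr1 !Hc ?subrr ?scaler0 ?eqxx //.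
  by rewrite ge_min le_max lexx.
move: es; have [lt|gt|E] := ltgtP s0 s1; last by rewrite E eqxx in ne.
  by rewrite gtr0_sg ?subr_gt0 // gtr0_norm ?subr_gt0 // => es; lra.
by rewrite ltr0_sg ?subr_lt0 // ltr0_norm ?subr_lt0 // => es; lra.
Qed.

Section Coefficient.
Variables (R : realType) (d : nat).
Implicit Types (phi : 'rV[R]_d -> R) (v x y : 'rV[R]_d) (j k : 'I_d).

(** The intermediate value theorem on the segment from x to y. *)
Lemma between_values phi x y (s : R) : continuous phi ->
  Num.min (phi x) (phi y) <= s <= Num.max (phi x) (phi y) ->
  exists z, phi z = s.
Proof.
move=> cphi hs.
pose l (a : R) := phi (x + a *: (y - x)).
have cl : continuous l.
  move=> a; apply: (@continuous_comp _ _ _ (fun a : R => x + a *: (y - x)) phi);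
    last exact: cphi.
  by apply: cvgD; [exact: cvg_cst|apply: cvgZr_tmp; exact: cvg_id].
have [||a _ aE] := @IVT R l 0 1 s ler01.
- exact: continuous_subspaceT.
- by rewrite /l scale0r addr0 scale1r addrC subrK.
- by exists (x + a *: (y - x)).
Qed.

(** For a primitive H of a g', the flux a(phi) grad g(phi) is the gradient of
    H(phi), so H(phi) is harmonic, hence constant, and H is constant between
    any two values of phi. *)
Lemma range_weighted_derivative_eq0 phi (a g : R -> R) :
  continuous phi -> Defs.periodic phi ->
  (forall k x, derivable phi x 'e_k) ->
  (forall s, derivable g s 1) ->
  continuous (fun s => a s * g^`()%classic s) ->
  (forall k x, derivable (fun y => a (phi y) * partial k (g \o phi) y) x 'e_k) ->
  (forall x, divergence (fun y => a (phi y) *: grad (g \o phi) y) x = 0) ->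
  (exists x y, phi x <> phi y) ->
  forall s, range phi s -> a s * g^`()%classic s = 0.
Proof.
move=> cphi pphi dphi dg cag dflux div0 [x1 [x2 ne12]] s0 [x0 _ <-].
have [M _ phiM] := periodic_bounded cphi pphi.
have phigt y : - (M + 1) < phi y.
  by have := phiM y; rewrite ler_norml => /andP[? _]; lra.
(* a primitive from - (M + 1) on suffices, as phi > - (M + 1) *)
have [H dH] := continuous_antiderivative (- (M + 1)) cag.
have partialH k : partial k (H \o phi) = (fun y => a (phi y) * partial k (g \o phi) y).
  apply/funext => y.
  have [_ E1] := is_derive_comp_along (derivableP (dphi k y)) (dH _ (phigt y)).
  have [_ E2] := is_derive_comp_along (derivableP (dphi k y)) (derivableP (dg (phi y))).
  by rewrite /partial E1 E2 derive1E mulrA.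
have Hharm : periodic_harmonic (H \o phi).
  split.
  - move=> y; apply: continuous_comp; first exact: cphi.
    have [dHy _] := dH _ (phigt y).
    by apply: differentiable_continuous; apply/derivable1_diffP.
  - by move=> k y; rewrite /= pphi.
  - move=> k y.
    by have [] := is_derive_comp_along (derivableP (dphi k y)) (dH _ (phigt y)).
  - by move=> k y; rewrite partialH.
  - move=> y; rewrite -[RHS](div0 y); apply: eq_bigr => k _.
    rewrite partialH; congr (partial k _ y); apply/funext => z.
    by rewrite !mxE.
have Hconst := periodic_harmonic_constant Hharm.
have [y ney] : exists y, phi x0 != phi y.
  have [E|] := eqVneq (phi x0) (phi x1); last by exists x1.
  by exists x2; rewrite E; apply/eqP.
apply: (derive_eq0_of_constant_on_interval (c := H (phi x0)) ney (dH _ (phigt x0))).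
move=> s /(between_values cphi)[z <-]; exact: Hconst.
Qed.

End Coefficient.

(** * The Cahn-Hilliard system *)

Lemma continuous_slice (R : realType) (d : nat) (T t : R) (u : R -> 'rV[R]_d -> R) :
  continuous_on_slab T u -> 0 <= t <= T -> continuous (u t).
Proof.
move=> cu tT x.
move/subspace_continuousP: cu => /(_ (t, x)); rewrite /= in_itv /= => /(_ (conj tT I)) cu.
apply: (@cvg_comp _ _ _ (fun y => (t, y)) (fun z : R * 'rV[R]_d => u z.1 z.2)) cu.
move=> A /=; rewrite /within /= => wA.
have : nbhs x ((fun y => (t, y)) @^-1` [set z | (`[0, T] `*` setT) z -> A z]).
  have ct : (fun y : 'rV[R]_d => (t, y)) @ x --> (t, x).
    by apply: (@cvg_pair _ _ _ (nbhs x) (nbhs t) (nbhs x));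
      [exact: cvg_cst|exact: cvg_id].
  exact: ct wA.
by apply: filterS => y /=; apply; split; rewrite //= in_itv.
Qed.

Lemma potential_derivative_C1 (R : realType) (f : R -> R) : potential_F f ->
  (forall s, derivable f s 1) /\ continuous f^`().
Proof.
move=> [F [kappa [p [q [[dF cF] fE _ _ _]]]]].
have -> : f = F^`(1) by apply/funext => s; rewrite fE derive1n1.
by split; [exact: dF|exact: (cF 2)].
Qed.

(* Without the hypothesis that phi1 t is not constant the conclusion fails:
   phi1 = phi2 = 0, mu1 = mu2 = 0 are solutions for F1 s = s ^+ 2 and F2 s = 0,
   but then f1' (0) = 2 and f2' (0) = 0. *)
Theorem theorem5 (R : realType) (d : nat) (hd : (1 <= d <= 3)%N)
  (gamma : R) (hgamma : 0 < gamma)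
  (b : R -> R) (hb : mobility_B b)
  (f1 f2 : R -> R) (hf1 : potential_F f1) (hf2 : potential_F f2)
  (T : R) (hT : 0 < T)
  (phi1 mu1 phi2 mu2 : R -> 'rV[R]_d -> R)
  (hsol1 : cahn_hilliard_solution gamma b f1 T phi1 mu1)
  (hsol2 : cahn_hilliard_solution gamma b f2 T phi2 mu2)
  (t : R) (ht : 0 <= t <= T)
  (hphi : forall x : 'rV[R]_d, phi1 t x = phi2 t x)
  (hdt : forall x : 'rV[R]_d, dt T phi1 t x = dt T phi2 t x)
  (hnonconst : exists x y : 'rV[R]_d, phi1 t x <> phi1 t y) :
  forall s : R, range (phi1 t) s -> f1^`() s = f2^`() s.
Proof.
have {}hphi : phi2 t = phi1 t by apply/esym/funext.
have [[db cb] [beta1 [beta2 [_ [_ [beta1_gt0 b_bounds _ _]]]]]] := hb.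
have [df1 cf1] := potential_derivative_C1 hf1.
have [df2 cf2] := potential_derivative_C1 hf2.
have [[_ [dphi cphi]] [dmu1 _] per1 eq1 muE1] := hsol1.
have [_ [dmu2 _] _ eq2 muE2] := hsol2.
set phi := phi1 t in hphi hnonconst *.
pose g := f1 - f2.
have gE : g \o phi = mu1 t - mu2 t.
  apply/funext => x; rewrite !fctE muE1 // muE2 // hphi -/phi /g !fctE.
  by rewrite opprD addrACA subrr add0r.
have dg s : derivable g s 1 by apply: derivableB.
have g'E : derive1 g = derive1 f1 - derive1 f2.
  apply/funext => s; rewrite derive1E deriveB //.
  by rewrite [RHS]/GRing.add /= ?fctE !derive1E.
have derphi k x : derivable phi x 'e_k by apply: (dphi [::]).
have partialg k : partial k (g \o phi) = partial k (mu1 t) - partial k (mu2 t).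
  by apply/funext => x; rewrite gE; apply: deriveB;
    [apply: (dmu1 [::])|apply: (dmu2 [::])].
have dbphi k x : derivable (b \o phi) x 'e_k.
  have dbx := derivableP (db 0%N isT (phi x)).
  by have [] := is_derive_comp_along (derivableP (derphi k x)) dbx.
have dflux k (mu : R -> 'rV[R]_d -> R) x : space_class_C 2 T mu ->
    derivable (fun y => b (phi y) * partial k (mu t) y) x 'e_k.
  by move=> [dmu _]; apply: derivableM; [exact: dbphi|apply: (dmu [:: k])].
have fluxE k : (fun y => b (phi y) * partial k (g \o phi) y) =
    (fun y => b (phi y) * partial k (mu1 t) y)
    - (fun y => b (phi y) * partial k (mu2 t) y).
  by apply/funext => y; rewrite partialg !fctE mulrBr.
have divE (u : 'rV[R]_d -> R) x : divergence (fun y => b (phi y) *: grad u y) x =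
   \sum_k partial k (fun y => b (phi y) * partial k u y) x.
  by apply: eq_bigr => k _; congr (partial k _ x); apply/funext => y; rewrite !mxE.
have bg' s : range phi s -> b s * g^`()%classic s = 0.
  apply: (range_weighted_derivative_eq0 _ (proj1 (per1 t ht)) derphi dg) => //.
  - exact: (continuous_slice (cphi [::] isT) ht).
  - move=> r; rewrite g'E; apply: cvgM; first exact: (cb 0%N).
    by apply: cvgB; [exact: cf1|exact: cf2].
  - by move=> k x; rewrite fluxE; apply: derivableB; apply: dflux; case: hsol1; case: hsol2.
  - move=> x; rewrite divE.
    transitivity (dt T phi1 t x - dt T phi2 t x); last by rewrite hdt subrr.
    rewrite eq1 // eq2 // hphi -/phi !divE -sumrB; apply: eq_bigr => k _.
    rewrite fluxE; apply: deriveB; apply: dflux; by case: hsol1; case: hsol2.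
move=> s /bg'/eqP; rewrite mulf_eq0 gt_eqF /=; last first.
  by apply: lt_le_trans beta1_gt0 _; have /andP[] := b_bounds s.
by rewrite g'E subr_eq0 => /eqP.
Qed.
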